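(* Let $N\ge 3$ be an integer, let $\mathcal{N}_{N-3},\mathcal{N}_{N-2},\mathcal{N}_{N-1},\mathcal{N}_N\in\mathbb{R}$, and set $$a_j=\frac{N+1}{2N+1}\mathcal{N}_j\ \ (j\in\{N-3,N-2,N\}),\qquad a_{N-1}=\frac{N}{2N+1}+\frac{N+1}{2N+1}\mathcal{N}_{N-1}.$$ Let $A\in\mathbb{R}^{(N+1)\times(N+1)}$ be the matrix, with rows and columns indexed by $0,1,\dots,N$, whose entries are $$A_{i,i+1}=\frac{i+1}{2i+1}\ (0\le i\le N-1),\qquad A_{i,i-1}=\frac{i}{2i+1}\ (1\le i\le N-1),\qquad A_{N,j}=a_j\ (N-3\le j\le N),$$ all other entries being $0$. Suppose that $$a_{N-3}>-\frac{(N-1)(N-2)}{N(2N-3)},\qquad a_{N-1}>\frac{g}{(N-2)\big(a_{N-3}(2N-3)N+(N-1)(N-2)\big)^2},\qquad (\ast)$$ where $$\begin{aligned} g={}&a_{N-3}^3(N-1)N^2(3-2N)^2+a_{N-2}(2N-1)(N-2)^3\big(a_{N-2}N-a_N(N-1)\big)\\&+a_{N-3}(N-2)^2\Big(a_N(4N^2-8N+3)\big(a_{N-2}N-a_N(N-1)\big)+(N-1)^3\Big)\\&+2a_{N-3}^2(N-1)^2N(2N-3)(N-2).\end{aligned}$$ Then there exists a symmetric positive definite matrix of block diagonal form $A_0=\operatorname{diag}(D,B)\in\mathbb{R}^{(N+1)\times(N+1)}$, where $D=\operatorname{diag}(1,3,5,\dots,2N-5)\in\mathbb{R}^{(N-2)\times(N-2)}$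 and $B\in\mathbb{R}^{3\times 3}$ is symmetric positive definite, such that $A_0A$ is symmetric. Moreover, $(\ast)$ is equivalent to $$\mathcal{N}_{N-3}>-\frac{(N-2)(N-1)(2N+1)}{N(2N-3)(N+1)},$$ $$\mathcal{N}_{N-1}>-\frac{N}{N+1}+\frac{h}{(N-2)\big(\mathcal{N}_{N-3}(N+1)(2N-3)N+(N-2)(N-1)(2N+1)\big)^2},$$ where $$\begin{aligned} h={}&\mathcal{N}_{N-3}^3(N-1)N^2(-2N^2+N+3)^2\\&+\mathcal{N}_{N-2}(N+1)(2N-1)(2N+1)(N-2)^3\big(\mathcal{N}_{N-2}N-\mathcal{N}_N(N-1)\big)\\&+\mathcal{N}_{N-3}(N-2)^2\Big(\mathcal{N}_N(N+1)^2(4N^2-8N+3)\big(\mathcal{N}_{N-2}N-\mathcal{N}_N(N-1)\big)+(2N+1)^2(N-1)^3\Big)\\&+2\mathcal{N}_{N-3}^2(N-1)^2N(N+1)(2N-3)(2N+1)(N-2).\end{aligned}$$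
   Context: All matrices are real. ''Symmetric positive definite'' means symmetric with all eigenvalues strictly positive. $\operatorname{diag}(D,B)$ denotes the block diagonal matrix with diagonal blocks $D$ and $B$. The second inequality in each pair is only considered together with the first one, under which the denominator is nonzero. *)

(* Defs.v *)
From mathcomp Require Import all_boot all_order all_algebra reals.
Set Implicit Arguments.
Unset Strict Implicit.
Unset Printing Implicit Defensive.
Import Order.TTheory GRing.Theory Num.Theory.
Local Open Scope ring_scope.

(* For a symmetric real matrix every complex eigenvalue is real, so only the
   eigenvalues in [R] need to be considered. *)
Definition sym_posdef (R : realType) (n : nat) (M : 'M[R]_n) : Prop :=
  M \is symmetricmx /\ forall l : R, eigenvalue M l -> 0 < l.

(* Suffixes count down from [N]: [a3], [a2], [a1], [a0] are the entries of the
   last row in columns N-3, N-2, N-1, N; likewise [c3], ..., [c0] stand for the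
   free parameters \mathcal{N}_{N-3}, ..., \mathcal{N}_N. *)

Definition Amx (R : realType) (N : nat) (a3 a2 a1 a0 : R) : 'M[R]_(N.+1) :=
  \matrix_(i < N.+1, j < N.+1)
    if i == N :> nat then
      if j == (N - 3)%N :> nat then a3
      else if j == (N - 2)%N :> nat then a2
      else if j == (N - 1)%N :> nat then a1
      else if j == N :> nat then a0
      else 0
    else
      if j == (i + 1)%N :> nat then (i%:R + 1) / (2 * i%:R + 1)
      else if i == (j + 1)%N :> nat then i%:R / (2 * i%:R + 1)
      else 0.

Definition Dmx (R : realType) (N : nat) : 'M[R]_(N - 2) :=
  diag_mx (\row_(i < N - 2) (2 * i%:R + 1)).

Lemma split_dim (N : nat) : (3 <= N)%N -> (N - 2 + 3 = N.+1)%N.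
Proof. by case: N => [|[|[|n]]] //= _; rewrite subSS subSS subn0 addn3. Qed.

(* The blocks have total size (N - 2) + 3, which is only propositionally N.+1. *)
Definition diag_DB (R : realType) (N : nat) (hN : (3 <= N)%N) (B : 'M[R]_3) :
    'M[R]_(N.+1) :=
  castmx (split_dim hN, split_dim hN) (block_mx (Dmx R N) 0 0 B).

Definition gpoly (R : realType) (N : nat) (a3 a2 a0 : R) : R :=
  let n : R := N%:R in
    a3 ^+ 3 * (n - 1) * n ^+ 2 * (3 - 2 * n) ^+ 2
  + a2 * (2 * n - 1) * (n - 2) ^+ 3 * (a2 * n - a0 * (n - 1))
  + a3 * (n - 2) ^+ 2 *
      (a0 * (4 * n ^+ 2 - 8 * n + 3) * (a2 * n - a0 * (n - 1)) + (n - 1) ^+ 3)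
  + 2 * a3 ^+ 2 * (n - 1) ^+ 2 * n * (2 * n - 3) * (n - 2).

Definition hpoly (R : realType) (N : nat) (c3 c2 c0 : R) : R :=
  let n : R := N%:R in
    c3 ^+ 3 * (n - 1) * n ^+ 2 * (- 2 * n ^+ 2 + n + 3) ^+ 2
  + c2 * (n + 1) * (2 * n - 1) * (2 * n + 1) * (n - 2) ^+ 3
      * (c2 * n - c0 * (n - 1))
  + c3 * (n - 2) ^+ 2 *
      (c0 * (n + 1) ^+ 2 * (4 * n ^+ 2 - 8 * n + 3) * (c2 * n - c0 * (n - 1))
       + (2 * n + 1) ^+ 2 * (n - 1) ^+ 3)
  + 2 * c3 ^+ 2 * (n - 1) ^+ 2 * n * (n + 1) * (2 * n - 3) * (2 * n + 1)
      * (n - 2).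

Definition cond_a (R : realType) (N : nat) (a3 a2 a1 a0 : R) : Prop :=
  let n : R := N%:R in
  a3 > - (((n - 1) * (n - 2)) / (n * (2 * n - 3))) /\
  a1 > gpoly N a3 a2 a0
       / ((n - 2) * (a3 * (2 * n - 3) * n + (n - 1) * (n - 2)) ^+ 2).

Definition cond_c (R : realType) (N : nat) (c3 c2 c1 c0 : R) : Prop :=
  let n : R := N%:R in
  c3 > - (((n - 2) * (n - 1) * (2 * n + 1)) / (n * (2 * n - 3) * (n + 1))) /\
  c1 > - (n / (n + 1))
       + hpoly N c3 c2 c0
         / ((n - 2) * (c3 * (n + 1) * (2 * n - 3) * n
                       + (n - 2) * (n - 1) * (2 * n + 1)) ^+ 2).

(* Main.v *)
(** Symmetry of [A0 *m A] amounts to six linear equations in the six entries of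
    [B]. Writing [t] for the last diagonal entry of [B], they determine [B], and the
    congruence [x2 |-> x2 - s * x0] splits off the diagonal entry [2 N - 3 > 0] and
    leaves a 2x2 block. Its positivity is [t > 0] and a discriminant condition, and
    both hold as soon as the two inequalities on [a3] and [a1] do. *)
Require Import Defs.
From mathcomp Require Import all_boot all_order all_algebra reals.
From mathcomp Require Import ring lra zify.
Import Order.TTheory GRing.Theory Num.Theory.
Local Open Scope ring_scope.

(** * Symmetric and positive definite matrices *)

(** An eigenvector [v] for [l] gives [v M v^T = l (v v^T)] with [v v^T >= 0], which excludes
    [l <= 0]. *)
Lemma sym_posdef_quadratic {R : realType} {n : nat} (M : 'M[R]_n) :
  M \is symmetricmx ->
  (forall v : 'rV[R]_n, v != 0 -> 0 < (v *m M *m v^T) 0 0) ->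
  sym_posdef M.
Proof.
move=> symM posM; split=> // l /eigenvalueP[v vM v0].
have := posM v v0; rewrite vM -scalemxAl mxE.
have vv : 0 <= (v *m v^T) 0 0.
  by rewrite mxE sumr_ge0 // => i _; rewrite !mxE -expr2 sqr_ge0.
by move=> h; rewrite ltNge; apply/negP => l0; move: h; rewrite ltNge mulr_le0_ge0.
Qed.

Lemma sym_posdef_cast {R : realType} {m n : nat} {e : m = n} (M : 'M[R]_m) :
  sym_posdef M -> sym_posdef (castmx (e, e) M).
Proof. by case: _ / e; rewrite castmx_id. Qed.

Lemma symmetricmx_cast {R : realType} {m n : nat} {e : m = n} (M : 'M[R]_m) :
  M \is symmetricmx -> castmx (e, e) M \is symmetricmx.
Proof. by case: _ / e; rewrite castmx_id. Qed.

(** Moving the cast onto the right factor lets the product with [Amx] be computed by blocks of sizes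
    [N - 2] and 3. *)
Lemma castmx_mul_sq {R : realType} {m n : nat} {e : m = n}
    (M : 'M[R]_m) (A : 'M[R]_n) :
  castmx (e, e) M *m A = castmx (e, e) (M *m castmx (esym e, esym e) A).
Proof. by move: A; case: _ / e => A; rewrite !castmx_id. Qed.

Lemma symmetricmxE {R : realType} {n : nat} (M : 'M[R]_n) :
  (forall i j, M i j = M j i) -> M \is symmetricmx.
Proof.
move=> h; rewrite qualifE /=; apply/eqP/matrixP=> i j.
by rewrite !mxE h /= expr0 ?mul1r ?scale1r.
Qed.

Lemma symmetricmx_sym {R : realType} {n : nat} (M : 'M[R]_n) :
  M \is symmetricmx -> forall i j, M i j = M j i.
Proof.
rewrite qualifE /= => /eqP hM i j; rewrite {1}hM !mxE.
by rewrite /= expr0 ?mul1r ?scale1r.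
Qed.

Lemma symmetricmx_block {R : realType} {m n : nat} (P : 'M[R]_m)
    (Q : 'M[R]_(m, n)) (S : 'M[R]_(n, m)) (T : 'M[R]_n) :
  P \is symmetricmx -> (forall i j, Q i j = S j i) -> T \is symmetricmx ->
  block_mx P Q S T \is symmetricmx.
Proof.
move=> /symmetricmx_sym symP QS /symmetricmx_sym symT.
apply: symmetricmxE => i j.
case: (split_ordP i) => i' ->; case: (split_ordP j) => j' ->;
  by rewrite ?block_mxEul ?block_mxEur ?block_mxEdl ?block_mxEdr ?QS.
Qed.

(** An eigenvector splits along the blocks. If its second part is nonzero, that part is an
    eigenvector of [B]; otherwise a nonzero coordinate of the first part forces [l] to be an entry
    of [d]. *)
Lemma sym_posdef_block_diag {R : realType} {m n : nat} (d : 'rV[R]_m)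
    (B : 'M[R]_n) :
  (forall i, 0 < d 0 i) -> sym_posdef B ->
  sym_posdef (block_mx (diag_mx d) 0 0 B).
Proof.
move=> d0 [symB posB]; split.
  apply: symmetricmx_block => // [|i j]; last by rewrite !mxE.
  apply: symmetricmxE => i j; rewrite !mxE eq_sym.
  by case: eqP => // ->.
move=> l /eigenvalueP[v]; rewrite -[v]hsubmxK.
set v1 := lsubmx v; set v2 := rsubmx v.
rewrite mul_row_block !mulmx0 addr0 add0r scale_row_mx.
move: v1 v2 => v1 v2 /eq_row_mx[v1E v2E] v0.
have [v20|v20] := eqVneq v2 0; last by apply: posB; apply/eigenvalueP; exists v2.
have /rV0Pn[i v1i] : v1 != 0.
  by apply: contraNneq v0 => v10; rewrite v10 v20 row_mx0.
move/rowP: v1E => /(_ i); rewrite mul_mx_diag !mxE mulrC => h; rewrite -(mulIf v1i h).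
exact: d0.
Qed.

Lemma sym_posdef_diag_DB {R : realType} {N : nat} {hN : (3 <= N)%N}
    (B : 'M[R]_3) :
  sym_posdef B -> sym_posdef (diag_DB hN B).
Proof.
move=> posB; apply/sym_posdef_cast/sym_posdef_block_diag => // i.
by rewrite mxE -natrM natr1 ltr0Sn.
Qed.

(** * The 3x3 block *)

Definition sym3 {R : realType} (p q r s t u : R) : 'M[R]_3 :=
  \matrix_(i, j) nth 0 (nth [::] [:: [:: p; q; r]; [:: q; s; t]; [:: r; t; u]] i) j.

Lemma sym3_symmetric {R : realType} (p q r s t u : R) :
  sym3 p q r s t u \is symmetricmx.
Proof.
apply: symmetricmxE => i j; rewrite !mxE.
by case: i j => -[|[|[|]]] // ? [[|[|[|]]]].
Qed.

(* Completing squares after the substitution [x2 - s * x0]: the quadratic form is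
   [e * x0 ^ 2 + b11 * x1 ^ 2 + 2 * b12 * x1 * (x2 - s * x0)
    + t * (x2 - s * x0) ^ 2]. *)
Lemma sym3_posdef {R : realType} (e s b11 b12 t : R) :
  0 < e -> 0 < t -> b12 ^+ 2 < b11 * t ->
  sym_posdef (sym3 (e + s ^+ 2 * t) (- s * b12) (- s * t) b11 b12 t).
Proof.
move=> e0 t0 disc; apply: sym_posdef_quadratic; first exact: sym3_symmetric.
move=> v v0; rewrite !mxE !big_ord_recl big_ord0 !mxE !big_ord_recl !big_ord0 !mxE /=.
set x0 := v 0 ord0; set x1 := v 0 (lift _ _); set x2 := v 0 (lift _ _).
(* After multiplication by [t] the square in [y] can be completed without division. *)
rewrite -(pmulr_rgt0 _ t0).
set y := x2 - s * x0.
rewrite [ltRHS](_ : _ = t * e * x0 ^+ 2 + (b11 * t - b12 ^+ 2) * x1 ^+ 2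
  + (t * y + b12 * x1) ^+ 2); last by rewrite /y; ring.
have k0 : 0 < t * e by rewrite mulr_gt0.
have k1 : 0 < b11 * t - b12 ^+ 2 by rewrite subr_gt0.
have h0 : 0 <= t * e * x0 ^+ 2 by rewrite mulr_ge0 ?sqr_ge0 // ltW.
have h1 : 0 <= (b11 * t - b12 ^+ 2) * x1 ^+ 2 by rewrite mulr_ge0 ?sqr_ge0 // ltW.
have h2 : 0 <= (t * y + b12 * x1) ^+ 2 by rewrite sqr_ge0.
have h01 := addr_ge0 h0 h1.
rewrite lt_neqAle eq_sym (addr_ge0 h01 h2) andbT.
apply: contraNneq v0 => /eqP; rewrite (paddr_eq0 h01 h2) (paddr_eq0 h0 h1).
rewrite !mulf_eq0 (gt_eqF t0) (gt_eqF e0) (gt_eqF k1) !orbb /=.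
move=> /andP[/andP[/eqP x00 /eqP x10]].
rewrite /y x00 x10 !mulr0 subr0 addr0 mulf_eq0 (gt_eqF t0) /= => /eqP x20.
apply/eqP/rowP=> -[[|[|[|//]]] hi]; rewrite mxE.
- by rewrite -[RHS]x00; congr (v _ _); apply: val_inj.
- by rewrite -[RHS]x10; congr (v _ _); apply: val_inj.
- by rewrite -[RHS]x20; congr (v _ _); apply: val_inj.
Qed.

(* With [s = a3 (2n-3)/(n-2)] and [u = (a2 + s a0)/(gamma + s delta)], where
   [beta = (n-1)/(2n-3)], [gamma = (n-1)/(2n-1)] and [delta = n/(2n-1)], the bound
   on [a1] is [E := a1 - s beta + u a0 - delta u^2 > 0]; the symmetry equations then force
   [t (s + gamma/delta) E = n - 1], [b12 = - t u] and [b11 = t (E/delta + u^2)]. *)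
Lemma block_solution {R : realType} {N : nat} (a3 a2 a1 a0 : R) :
  (3 <= N)%N -> cond_a N a3 a2 a1 a0 ->
  let n : R := N%:R in
  let s := a3 * (2 * n - 3) / (n - 2) in
  exists b11 b12 t,
  [/\ 0 < t, b12 ^+ 2 < b11 * t,
   - s * b12 * (n / (2 * n - 1)) + - s * t * a0
     = b12 * ((n - 1) / (2 * n - 1)) + t * a2,
   (2 * n - 3 + s ^+ 2 * t) * ((n - 1) / (2 * n - 3)) + - s * t * a1
     = b11 * ((n - 1) / (2 * n - 1)) + b12 * a2 &
   b11 * (n / (2 * n - 1)) + b12 * a0
     = - s * t * ((n - 1) / (2 * n - 3)) + t * a1].
Proof.
move=> hN [h3 h1] n s.
have n3 : 3 <= n by rewrite ler_nat.
have np : 0 < n by lra.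
have n1p : 0 < n - 1 by lra.
have n2p : 0 < n - 2 by lra.
have m1p : 0 < 2 * n - 1 by lra.
have m3p : 0 < 2 * n - 3 by lra.
set P := a3 * (2 * n - 3) * n + (n - 1) * (n - 2).
have Pp : 0 < P.
  have := h3; rewrite -/n -mulNr ltr_pdivrMr ?mulr_gt0 // /P => h.
  lra.
(* Here [a2 + s a0 = w / (n-2)] and [gamma + s delta = P / ((2n-1)(n-2))], which gives [u] in terms
   of [P]. *)
pose w := a2 * (n - 2) + (2 * n - 3) * a3 * a0.
pose u := w * (2 * n - 1) / P.
pose E := a1 - gpoly N a3 a2 a0 / ((n - 2) * P ^+ 2).
have Ep : 0 < E by rewrite subr_gt0; exact: h1.
have nz := (gt_eqF np, gt_eqF n1p, gt_eqF n2p, gt_eqF m1p, gt_eqF m3p, gt_eqF Pp, gt_eqF Ep).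
have EE : E = a1 - a3 * (n - 1) / (n - 2) + u * a0 - n / (2 * n - 1) * u ^+ 2.
  rewrite /E /u /w /gpoly -/n /P; field.
  by rewrite -/P !nz.
have a1E : a1 = E + a3 * (n - 1) / (n - 2) - u * a0 + n / (2 * n - 1) * u ^+ 2.
  by rewrite EE; ring.
(* This solves [t (s + gamma/delta) E = n - 1], since [s + gamma/delta = P / (n (n-2))]. *)
pose t := (n - 1) * n * (n - 2) / (P * E).
have tp : 0 < t by rewrite !(divr_gt0, mulr_gt0).
exists (t * (E * (2 * n - 1) / n + u ^+ 2)), (- t * u), t; split=> //.
- rewrite -subr_gt0 [ltRHS](_ : _ = t ^+ 2 * (E * (2 * n - 1) / n)); last by ring.
  by rewrite !(divr_gt0, mulr_gt0, exprn_gt0).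
- rewrite /s /u /w /P; field; by rewrite -/P !nz.
(* Of the three equations only this one fixes the value of [t]. With [a1] expressed through an
   opaque [E], [gpoly] stays out of the computation. *)
- rewrite a1E /s /t; clearbody E.
  rewrite /u /w /P; field; by rewrite -/P !nz.
- rewrite a1E /s; clearbody E t; field; by rewrite !nz.
Qed.

(** * The two forms of the conditions *)

(** In each inequality the difference of the two sides is scaled by [k = (n+1)/(2n+1) > 0]. For the
    second one this needs a nonzero denominator, which the first one provides. *)
Lemma cond_a_iff_cond_c {R : realType} {N : nat} (hN : (3 <= N)%N)
    (c3 c2 c1 c0 a3 a2 a1 a0 : R)
    (ha3 : a3 = (N%:R + 1) / (2 * N%:R + 1) * c3)
    (ha2 : a2 = (N%:R + 1) / (2 * N%:R + 1) * c2)
    (ha1 : a1 = N%:R / (2 * N%:R + 1) + (N%:R + 1) / (2 * N%:R + 1) * c1)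
    (ha0 : a0 = (N%:R + 1) / (2 * N%:R + 1) * c0) :
  cond_a N a3 a2 a1 a0 <-> cond_c N c3 c2 c1 c0.
Proof.
rewrite /cond_a /cond_c /=; set n : R := N%:R.
have n3 : 3 <= n by rewrite ler_nat.
have np : 0 < n by lra.
have k1p : 0 < n + 1 by lra.
have n2p : 0 < n - 2 by lra.
have m1p : 0 < 2 * n + 1 by lra.
have m3p : 0 < 2 * n - 3 by lra.
have nz := (gt_eqF np, gt_eqF k1p, gt_eqF n2p, gt_eqF m1p, gt_eqF m3p).
pose k := (n + 1) / (2 * n + 1).
have kp : 0 < k by rewrite divr_gt0.
set l3 := - (_ / _); set l1 := _ / _; set r3 := - (_ / _); set r1 := _ + _ / _.
have E3 : a3 - l3 = k * (c3 - r3).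
  by rewrite ha3 /l3 /r3 -/n /k; field; rewrite !nz.
have A : (a3 > l3) = (c3 > r3).
  by rewrite -subr_gt0 E3 pmulr_rgt0 // subr_gt0.
have E1 : r3 < c3 -> a1 - l1 = k * (c1 - r1).
  move=> c3r.
  have Qp : 0 < c3 * (n + 1) * (2 * n - 3) * n + (n - 2) * (n - 1) * (2 * n + 1).
    move: c3r; rewrite /r3 -mulNr ltr_pdivrMr ?mulr_gt0 // => h; lra.
  rewrite /l1 /r1 /gpoly /hpoly -/n ha3 ha2 ha1 ha0 -/n /k.
  field.
  by rewrite (gt_eqF Qp) !nz /= ?andbT.
rewrite A; split=> -[h3 h1]; split=> //; move: h1;
  by rewrite -(subr_gt0 l1) E1 // pmulr_rgt0 // subr_gt0.
Qed.

(** * Symmetry of the product *)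

(** Scaling row [i] by [2i+1] makes the entries at [(i, i+1)] and [(i+1, i)] of the upper left block
    both [i+1]. The first three equations match the off-diagonal blocks, the last three are the
    symmetry of the lower right block. *)
Lemma diag_DB_mul_symmetric {R : realType} {N : nat} (hN : (3 <= N)%N)
    (a3 a2 a1 a0 b00 b01 b02 b11 b12 b22 : R) (n := N%:R : R) :
  b00 * ((n - 2) / (2 * n - 3)) + b02 * a3 = n - 2 ->
  b01 * ((n - 2) / (2 * n - 3)) + b12 * a3 = 0 ->
  b02 * ((n - 2) / (2 * n - 3)) + b22 * a3 = 0 ->
  b00 * ((n - 1) / (2 * n - 3)) + b02 * a1 = b11 * ((n - 1) / (2 * n - 1)) + b12 * a2 ->
  b01 * (n / (2 * n - 1)) + b02 * a0 = b12 * ((n - 1) / (2 * n - 1)) + b22 * a2 ->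
  b11 * (n / (2 * n - 1)) + b12 * a0 = b02 * ((n - 1) / (2 * n - 3)) + b22 * a1 ->
  diag_DB hN (sym3 b00 b01 b02 b11 b12 b22) *m Amx N a3 a2 a1 a0 \is symmetricmx.
Proof.
move=> e00 e10 e20 e01 e02 e12.
rewrite /diag_DB castmx_mul_sq; apply: symmetricmx_cast.
set A := castmx _ _.
have n2E : (N - 2)%:R = n - 2 by rewrite natrB //; lia.
have n1E : (N - 1)%:R = n - 1 by rewrite natrB //; lia.
have AE i j : A i j = Amx N a3 a2 a1 a0 (cast_ord (split_dim hN) i)
    (cast_ord (split_dim hN) j).
  by rewrite castmxE; congr (Amx _ _ _ _ _ _ _); apply: val_inj.
have ulE i j : ulsubmx A i j * (2 * i%:R + 1)
    = if j == (i + 1)%N :> nat then i%:R + 1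
      else if i == (j + 1)%N :> nat then i%:R else 0.
  have i0 : 2 * i%:R + 1 != 0 :> R by rewrite -natrM natr1 pnatr_eq0.
  have hi := ltn_ord i.
  rewrite 2!mxE AE mxE /= ifN; last by apply/eqP; lia.
  by do 2?case: ifP => _; rewrite ?mul0r ?divfK.
have urE i j : ursubmx A i j * (2 * i%:R + 1)
    = if (i == N - 3 :> nat)%N && (j == 0 :> nat)%N then n - 2 else 0.
  have i0 : 2 * i%:R + 1 != 0 :> R by rewrite -natrM natr1 pnatr_eq0.
  have hi := ltn_ord i.
  rewrite 2!mxE AE mxE /= ifN; last by apply/eqP; lia.
  do 4?[case: eqP => ? /=]; rewrite ?mul0r // ?divfK //; try (exfalso; lia).
  by rewrite -n2E natr1; congr _%:R; lia.
(* Rows [k = 0, 1, 2] are rows [N-2, N-1, N] of [Amx]; left of the split they meet only column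
   [N-3], through the subdiagonal entry of row [N-2] and through [a3]. *)
have dlE k j : dlsubmx A k j
    = if (j == N - 3 :> nat)%N then nth 0 [:: (n - 2) / (2 * n - 3); 0; a3] k else 0.
  have hj := ltn_ord j.
  rewrite 2!mxE AE mxE /=.
  case: k => -[|[|[|//]]] hk /=; rewrite ?addn0.
  - rewrite ifN; last by apply/eqP; lia.
    rewrite ifN; last by apply/eqP; lia.
    have -> : (N - 2 == j + 1)%N = (j == N - 3 :> nat)%N by lia.
    by rewrite n2E (_ : 2 * (n - 2) + 1 = 2 * n - 3) //; ring.
  - rewrite ifN; last by apply/eqP; lia.
    rewrite ifN; last by apply/eqP; lia.
    rewrite ifN; last by apply/eqP; lia.
    by rewrite if_same.
  - rewrite ifT; last by apply/eqP; lia.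
    case: ifP => // _.
    by do 3!(rewrite ifN; last by apply/eqP; lia).
have drE k l : drsubmx A k l
    = nth 0 (nth [::] [:: [:: 0; (n - 1) / (2 * n - 3); 0];
        [:: (n - 1) / (2 * n - 1); 0; n / (2 * n - 1)]; [:: a2; a1; a0]] k) l.
  have d3 : 2 * (n - 2) + 1 = 2 * n - 3 by ring.
  have d1 : 2 * (n - 1) + 1 = 2 * n - 1 by ring.
  have s2 : n - 2 + 1 = n - 1 by ring.
  rewrite 2!mxE AE mxE /=.
  have E1 : (N - 2 + 1 = N - 1)%N by lia.
  have E2 : (N - 2 + 2 = N)%N by lia.
  case: k l => -[|[|[|//]]] hk [[|[|[|//]]] hl] /=; rewrite ?addn0 ?E1 ?E2;
    do ?[case: eqP => ? /=]; rewrite ?n1E ?n2E ?d3 ?d1 ?s2 ?subrK //;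
    exfalso; lia.
have DE p (M : 'M_(N - 2, p)) i j : (Dmx R N *m M) i j = M i j * (2 * i%:R + 1).
  by rewrite mul_diag_mx !mxE mulrC.
rewrite -[A]submxK mulmx_block !mul0mx !addr0 !add0r.
apply: symmetricmx_block.
- apply: symmetricmxE => i j; rewrite !DE !ulE.
  do 2?[case: eqP => ?]; try (exfalso; lia); last by [].
  + by rewrite natr1; congr _%:R; lia.
  + by rewrite natr1; congr _%:R; lia.
- move=> i j; rewrite DE urE [RHS]mxE !big_ord_recl big_ord0 !dlE !mxE /=.
  case: (i == N - 3 :> nat)%N => /=; last by rewrite !mulr0 !addr0.
  rewrite mulr0 add0r addr0.
  by case: j => -[|[|[|//]]] hj /=; rewrite ?e00 ?e10 ?e20.
- apply: symmetricmxE => i j.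
  rewrite !mxE !big_ord_recl !big_ord0 !drE !mxE /=.
  case: i j => -[|[|[|//]]] hi [[|[|[|//]]] hj] //=;
    by rewrite !mulr0 ?addr0 ?add0r ?(e01, e02, e12).
Qed.

Theorem theorem2p1 (R : realType) (N : nat) (hN : (3 <= N)%N)
    (c3 c2 c1 c0 a3 a2 a1 a0 : R)
    (ha3 : a3 = (N%:R + 1) / (2 * N%:R + 1) * c3)
    (ha2 : a2 = (N%:R + 1) / (2 * N%:R + 1) * c2)
    (ha1 : a1 = N%:R / (2 * N%:R + 1) + (N%:R + 1) / (2 * N%:R + 1) * c1)
    (ha0 : a0 = (N%:R + 1) / (2 * N%:R + 1) * c0) :
  (cond_a N a3 a2 a1 a0 ->
     exists (A0 : 'M[R]_(N.+1)) (B : 'M[R]_3),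
       [/\ A0 = diag_DB hN B,
           sym_posdef A0,
           sym_posdef B &
           A0 *m Amx N a3 a2 a1 a0 \is symmetricmx]) /\
  (cond_a N a3 a2 a1 a0 <-> cond_c N c3 c2 c1 c0).
Proof.
split; last exact: cond_a_iff_cond_c.
move=> hc; have [b11 [b12 [t []]]] := block_solution _ _ _ _ hN hc.
set n : R := N%:R; set s := _ / _ => t0 disc e02 e01 e12.
have n3 : 3 <= n by rewrite ler_nat.
have n2p : 0 < n - 2 by lra.
have m3p : 0 < 2 * n - 3 by lra.
have posB := sym3_posdef _ s _ _ _ m3p t0 disc.
exists (diag_DB hN (sym3 (2 * n - 3 + s ^+ 2 * t) (- s * b12) (- s * t) b11 b12 t)).
eexists; split; [by []| exact: sym_posdef_diag_DB | exact: posB |].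
have nz := (gt_eqF n2p, gt_eqF m3p).
(* The first row of the block solves the three coupling equations because [s (n-2)/(2n-3) = a3]. *)
by apply: diag_DB_mul_symmetric; rewrite // -/n /s; field; rewrite !nz.
Qed.
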